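(* Let $k$ be a field, let $(A,\cdot,\circ)$ be a Hopf brace over $k$, and let $H$ be a commutative and cocommutative Hopf algebra over $k$ with antipode $S$. Let $\blacktriangleright : H\otimes A\to A$ and $\blacktriangleleft : H\otimes A\to H$ be linear maps such that $(A,\blacktriangleright)$, with $A=(A,\cdot)$, is a left $H$-module algebra, and such that $A_\circ$ and $H$ together with the left action $\blacktriangleright$ of $H$ on $A_\circ$ and the right action $\blacktriangleleft$ of $A_\circ$ on $H$ form a matched pair of Hopf algebras. Assume that for all $a,a'\in A$ and $x\in H$ $$x\blacktriangleleft (aa') = (x_{(1)}\blacktriangleleft a)\,S(x_{(2)})\,(x_{(3)}\blacktriangleleft a').$$ Then the tensor product coalgebra $A\otimes H$ together with the two algebra structures $$(a\otimes x)(b\otimes y) = ab\otimes xy,$$ $$(a\otimes x)\circ(b\otimes y) = a\circ (x_{(1)}\blacktriangleright b_{(1)})\otimes (x_{(2)}\blacktriangleleft b_{(2)})\,y$$ ($a,b\in A$, $x,y\in H$) is a Hopf brace.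
   Context: All vector spaces, tensor products, algebras, coalgebras and Hopf algebras are over the field $k$. Sweedler notation $\Delta(c)=c_{(1)}\otimes c_{(2)}$ is used with summation suppressed. Hopf brace: a Hopf brace over a coalgebra $(H,\Delta,\varepsilon)$ consists of two Hopf algebra structures $(H,\cdot,1,\Delta,\varepsilon,S)$ and $(H,\circ,1_\circ,\Delta,\varepsilon,T)$ on the same coalgebra such that for all $x,y,z\in H$ $$x\circ(yz) = (x_{(1)}\circ y)\,S(x_{(2)})\,(x_{(3)}\circ z),$$ where juxtaposition denotes the product $\cdot$ (it follows that $1=1_\circ$). One writes $(H,\cdot,\circ)$ for the Hopf brace, $H$ for the first Hopf algebra and $H_\circ$ for the second. In a pair of algebra structures on a coalgebra said to be a Hopf brace, the one written by juxtaposition plays the role of $\cdot$ and the other that of $\circ$. Matched pair: for Hopf algebras $A$, $H$, a matched pair consists of coalgebra maps $\triangleleft : H\otimes A\to H$ and $\triangleright : H\otimes A\to A$ such that $(A,\triangleright)$ is a left $H$-module coalgebra, $(H,\triangleleft)$ is a right $A$-module coalgebra, and for all $a,b\in A$, $x,y\in H$: $x\triangleright 1_A=\varepsilon_H(x)1_A$ and $1_H\triangleleft a=\varepsilon_A(a)1_H$; $x\triangleright(ab)=(x_{(1)}\triangleright a_{(1)})\big((x_{(2)}\triangleleft a_{(2)})\triangleright b\big)$; $(xy)\triangleleft a=\big(x\triangleleft(y_{(1)}\triangleright a_{(1)})\big)(y_{(2)}\triangleleft a_{(2)})$; $x_{(1)}\triangleleft a_{(1)}\otimes x_{(2)}\triangleright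 a_{(2)}=x_{(2)}\triangleleft a_{(2)}\otimes x_{(1)}\triangleright a_{(1)}$. (When the first Hopf algebra is $A_\circ$, the products of elements of $A$ in these axioms are taken with respect to $\circ$.) Left $H$-module algebra: a left $H$-module structure on an algebra with $x\cdot(ab)=(x_{(1)}\cdot a)(x_{(2)}\cdot b)$ and $x\cdot 1=\varepsilon(x)1$. *)

(* Defs.v *)
From HB Require Import structures.
From mathcomp Require Import all_boot all_algebra.
From mathcomp Require Import boolp.

Set Implicit Arguments.
Unset Strict Implicit.
Unset Printing Implicit Defensive.

Import GRing.Theory.
Local Open Scope ring_scope.
Local Open Scope quotient_scope.

Declare Scope tensor_scope.
Delimit Scope tensor_scope with T.
Local Open Scope tensor_scope.

Reserved Notation "V \ox W" (at level 40, left associativity).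
Reserved Notation "v \ot w" (at level 40, left associativity).
Reserved Notation "\sw_ ( x , y <- t ) E"
  (at level 41, x binder, y binder, t at level 99, E at level 41,
   format "'[' \sw_ ( x ,  y  <-  t ) '/  '  E ']'").

(* [s : seq (V * W)] stands for the formal sum of the v (x) w, (v, w) in s;
   scalars are absorbed in the first factor, so the tensor product is the
   quotient of the free monoid on V * W by the congruence below. *)
Section Tensor.
Variables (k : fieldType) (V W : lmodType k).

Inductive tens_eq : seq (V * W) -> seq (V * W) -> Prop :=
| tens_eq_refl s : tens_eq s s
| tens_eq_sym s t : tens_eq s t -> tens_eq t s
| tens_eq_trans s t u : tens_eq s t -> tens_eq t u -> tens_eq s u
| tens_eq_cat s s' t t' :
    tens_eq s s' -> tens_eq t t' -> tens_eq (s ++ t) (s' ++ t')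
| tens_eq_catC s t : tens_eq (s ++ t) (t ++ s)
| tens_eq_0l w : tens_eq [:: (0, w)] [::]
| tens_eq_Dl v v' w : tens_eq [:: (v + v', w)] [:: (v, w); (v', w)]
| tens_eq_Dr v w w' : tens_eq [:: (v, w + w')] [:: (v, w); (v, w')]
| tens_eq_Z a v w : tens_eq [:: (a *: v, w)] [:: (v, a *: w)].

Definition tens_eqb : rel (seq (V * W)) := fun s t => `[< tens_eq s t >].

Fact tens_eqb_refl : reflexive tens_eqb.
Proof. by move=> s; apply/asboolP; exact: tens_eq_refl. Qed.

Fact tens_eqb_sym : symmetric tens_eqb.
Proof.
by move=> s t; apply/asboolP/asboolP; apply: tens_eq_sym.
Qed.

Fact tens_eqb_trans : transitive tens_eqb.
Proof.
move=> t s u /asboolP st /asboolP tu; apply/asboolP.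
exact: tens_eq_trans st tu.
Qed.

Canonical tens_equiv := EquivRel tens_eqb tens_eqb_refl tens_eqb_sym tens_eqb_trans.

Definition tensor := {eq_quot tens_equiv}.
HB.instance Definition _ := Choice.on tensor.

Definition to_tens (s : seq (V * W)) : tensor := \pi_{eq_quot tens_equiv} s.
Definition tens_repr (t : tensor) : seq (V * W) := repr (t : {eq_quot tens_equiv}).

Lemma tens_reprK t : to_tens (tens_repr t) = t.
Proof. exact: reprK. Qed.

Lemma to_tens_eqP s t : to_tens s = to_tens t <-> tens_eq s t.
Proof. by split=> [/eqquotP/asboolP|st]//; apply/eqquotP/asboolP. Qed.

Lemma tens_repr_eq s : tens_eq (tens_repr (to_tens s)) s.
Proof. by apply/to_tens_eqP; rewrite tens_reprK. Qed.

Definition tens_zero : tensor := to_tens [::].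
Definition tens_add (s t : tensor) : tensor :=
  to_tens (tens_repr s ++ tens_repr t).
Definition tens_scale (a : k) (t : tensor) : tensor :=
  to_tens [seq (a *: p.1, p.2) | p <- tens_repr t].
Definition tens_opp (t : tensor) : tensor := tens_scale (-1) t.

Lemma tens_addE s t : tens_add (to_tens s) (to_tens t) = to_tens (s ++ t).
Proof. by apply/to_tens_eqP; apply: tens_eq_cat; apply: tens_repr_eq. Qed.

Lemma tens_eq_scale a s t : tens_eq s t ->
  tens_eq [seq (a *: p.1, p.2) | p <- s] [seq (a *: p.1, p.2) | p <- t].
Proof.
elim=> {s t} [s|s t _|s t u _ st _ tu|s s' t t' _ ss' _ tt'|s t|w|v v' w|v w w'|b v w].
- exact: tens_eq_refl.
- exact: tens_eq_sym.
- exact: tens_eq_trans st tu.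
- by rewrite !map_cat; apply: tens_eq_cat.
- by rewrite !map_cat; apply: tens_eq_catC.
- by rewrite /= scaler0; apply: tens_eq_0l.
- by rewrite /= scalerDr; apply: tens_eq_Dl.
- exact: tens_eq_Dr.
- by rewrite /= scalerA mulrC -scalerA; apply: tens_eq_Z.
Qed.

Lemma tens_scaleE a s :
  tens_scale a (to_tens s) = to_tens [seq (a *: p.1, p.2) | p <- s].
Proof. by apply/to_tens_eqP; apply/tens_eq_scale/tens_repr_eq. Qed.

Fact tens_addA : associative tens_add.
Proof.
move=> s t u; rewrite -[s]tens_reprK -[t]tens_reprK -[u]tens_reprK.
by rewrite !tens_addE catA.
Qed.

Fact tens_addC : commutative tens_add.
Proof. by move=> s t; apply/to_tens_eqP/tens_eq_catC. Qed.

Fact tens_add0 : left_id tens_zero tens_add.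
Proof. by move=> t; rewrite -[t]tens_reprK tens_addE. Qed.

Fact tens_scaleDl t : {morph tens_scale^~ t : a b / a + b >-> tens_add a b}.
Proof.
move=> a b; rewrite -[t]tens_reprK !tens_scaleE tens_addE.
elim: (tens_repr t) => //= -[v w] s /to_tens_eqP ih; apply/to_tens_eqP => /=.
apply: (@tens_eq_trans _ ([:: (a *: v, w); (b *: v, w)] ++
  [seq ((a + b) *: p.1, p.2) | p <- s])).
  rewrite -cat1s; apply: tens_eq_cat; last exact: tens_eq_refl.
  by rewrite scalerDl; apply: tens_eq_Dl.
rewrite -[X in X ++ _]cat1s -catA -[X in tens_eq _ X]cat1s.
apply: tens_eq_cat; first exact: tens_eq_refl.
apply: tens_eq_trans; first by apply: tens_eq_cat ih; apply: tens_eq_refl.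
rewrite catA -[X in tens_eq _ (_ ++ X)]cat1s catA.
by apply: tens_eq_cat (tens_eq_refl _); apply: tens_eq_catC.
Qed.

Fact tens_scale0 t : tens_scale 0 t = tens_zero.
Proof.
rewrite -[t]tens_reprK tens_scaleE.
elim: (tens_repr t) => //= -[v w] s /to_tens_eqP ih; apply/to_tens_eqP => /=.
rewrite -cat1s; apply: (@tens_eq_cat _ [::] _ [::]) => //.
by rewrite scale0r; apply: tens_eq_0l.
Qed.

Fact tens_scale1 : left_id 1 tens_scale.
Proof.
move=> t; rewrite -[t]tens_reprK tens_scaleE; congr to_tens.
by elim: (tens_repr t) => //= -[v w] s ->; rewrite scale1r.
Qed.

Fact tens_addN : left_inverse tens_zero tens_opp tens_add.
Proof.
move=> t; rewrite -{2}[t]tens_scale1 /tens_opp -tens_scaleDl addNr.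
exact: tens_scale0.
Qed.

HB.instance Definition _ :=
  GRing.isZmodule.Build tensor tens_addA tens_addC tens_add0 tens_addN.

Fact tens_scaleA a b t : tens_scale a (tens_scale b t) = tens_scale (a * b) t.
Proof.
rewrite -[t]tens_reprK !tens_scaleE -map_comp; congr to_tens.
by apply: eq_map => p /=; rewrite scalerA.
Qed.

Fact tens_scaleDr : right_distributive tens_scale +%R.
Proof.
move=> a s t; rewrite -[s]tens_reprK -[t]tens_reprK.
by rewrite [in LHS]/GRing.add /= !(tens_addE, tens_scaleE) map_cat
   [in RHS]/GRing.add /= tens_addE.
Qed.

HB.instance Definition _ := GRing.Zmodule_isLmodule.Build k tensor
  tens_scaleA tens_scale1 tens_scaleDr tens_scaleDl.

Definition tens (v : V) (w : W) : tensor := to_tens [:: (v, w)].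

End Tensor.

Notation "V \ox W" := (tensor V W) : type_scope.
Notation "v \ot w" := (tens v w) : tensor_scope.

Definition bilin (k : fieldType) (U V W : lmodType k) (f : U -> V -> W) : Prop :=
  (forall u, linear (f u)) /\ (forall v, linear (f^~ v)).

(* The linear map V \ox W -> U induced by f, evaluated at t.  It is computed on
   a chosen representative of t; the choice is irrelevant when f is bilinear
   (see [tens_lift_tens] and [tens_lift_linear]), which is the only case in
   which it is used. *)
Definition tens_lift (k : fieldType) (V W U : lmodType k) (f : V -> W -> U)
    (t : V \ox W) : U :=
  \sum_(p <- tens_repr t) f p.1 p.2.

(* Sweedler notation: for t = sum of x_(1) (x) x_(2), the sum of E x_(1) x_(2). *)
Notation "\sw_ ( x , y <- t ) E" := (tens_lift (fun x y => E) t) : tensor_scope.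

Section TensorTheory.
Variables (k : fieldType) (V W U : lmodType k).

Lemma tens_bilin : bilin (@tens k V W).
Proof.
split=> [v a w w'|w a v v']; rewrite /tens.
  rewrite /GRing.scale /= tens_scaleE /GRing.add /= tens_addE.
  apply/to_tens_eqP; apply: tens_eq_trans (tens_eq_Dr _ _ _) _.
  apply: (@tens_eq_cat _ _ _ [:: _] _ [:: _] [:: _]); last exact: tens_eq_refl.
  by apply: tens_eq_sym; apply: tens_eq_Z.
rewrite /GRing.scale /= tens_scaleE /GRing.add /= tens_addE.
by apply/to_tens_eqP; apply: tens_eq_Dl.
Qed.

Lemma tens_ind (P : V \ox W -> Prop) :
  P 0 -> (forall s t, P s -> P t -> P (s + t)) -> (forall v w, P (v \ot w)) ->
  forall t, P t.
Proof.
move=> P0 PD Pt t; rewrite -[t]tens_reprK; elim: (tens_repr t) => // -[v w] s ih.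
by rewrite -cat1s -tens_addE; apply: PD => //; apply: Pt.
Qed.

Variable f : V -> W -> U.
Hypothesis f_bilin : bilin f.

Lemma tens_lift_to_tens s : tens_lift f (to_tens s) = \sum_(p <- s) f p.1 p.2.
Proof.
have fDr v w w' : f v (w + w') = f v w + f v w'.
  by have := f_bilin.1 v 1 w w'; rewrite !scale1r.
have fDl v v' w : f (v + v') w = f v w + f v' w.
  by have := f_bilin.2 w 1 v v'; rewrite !scale1r.
have f0r v : f v 0 = 0 by apply: (addrI (f v 0)); rewrite -fDr !addr0.
have f0l w : f 0 w = 0 by apply: (addrI (f 0 w)); rewrite -fDl !addr0.
have fZr v a w : f v (a *: w) = a *: f v w.
  by have := f_bilin.1 v a w 0; rewrite f0r !addr0.
have fZl a v w : f (a *: v) w = a *: f v w.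
  by have := f_bilin.2 w a v 0; rewrite /= f0l !addr0.
suff eqf s' t : tens_eq s' t ->
    \sum_(p <- s') f p.1 p.2 = \sum_(p <- t) f p.1 p.2.
  exact/eqf/tens_repr_eq.
elim=> {s s' t} [s|s t _ ->|s t u _ -> _ ->|s s' t t' _ ss' _ tt'|s t|w|v v' w|v w w'|b v w] //.
- by rewrite !big_cat /= ss' tt'.
- by rewrite !big_cat /= addrC.
- by rewrite big_seq1 big_nil /= f0l.
- by rewrite !big_cons !big_nil !addr0 /= fDl.
- by rewrite !big_cons !big_nil !addr0 /= fDr.
- by rewrite !big_seq1 /= fZl fZr.
Qed.

Lemma tens_lift_tens v w : tens_lift f (v \ot w) = f v w.
Proof. by rewrite tens_lift_to_tens big_seq1. Qed.

Lemma tens_lift_linear : linear (tens_lift f).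
Proof.
have [_ fl] := f_bilin.
move=> a s t; rewrite -[s]tens_reprK -[t]tens_reprK.
rewrite {1}/GRing.scale /= tens_scaleE {1}/GRing.add /= tens_addE.
rewrite !tens_lift_to_tens big_cat big_map /= scaler_sumr; congr (_ + _).
have f0l w : f 0 w = 0.
  have := fl w 1 0 0; rewrite !scale1r addr0 => /eqP.
  by rewrite -subr_eq0 opprD addNKr oppr_eq0 => /eqP.
by apply: eq_bigr => p _; have := fl p.2 a p.1 0; rewrite f0l !addr0.
Qed.

Lemma tens_lift_unique (g : V \ox W -> U) :
  linear g -> (forall v w, g (v \ot w) = f v w) -> g =1 tens_lift f.
Proof.
move=> gl gf.
have gD s t : g (s + t) = g s + g t by have := gl 1 s t; rewrite !scale1r.
have lD s t : tens_lift f (s + t) = tens_lift f s + tens_lift f t.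
  by have := tens_lift_linear 1 s t; rewrite !scale1r.
apply: tens_ind => [|s t|v w]; last by rewrite gf tens_lift_tens.
  have -> : g 0 = 0 by apply: (addrI (g 0)); rewrite -gD !addr0.
  by apply: (addrI (tens_lift f 0)); rewrite -lD !addr0.
by rewrite gD lD => -> ->.
Qed.

End TensorTheory.

(* Structures are predicates on operations rather than canonical structures,
   since a Hopf brace carries two algebra structures on one vector space. *)
Section Structures.
Variable k : fieldType.
Implicit Types A C D H M : lmodType k.

Record is_algebra A (mul : A -> A -> A) (one : A) : Prop := IsAlgebra {
  mul_bilin : bilin mul;
  mul_assoc : associative mul;
  mul_1l : left_id one mul;
  mul_1r : right_id one mul }.

(* Coassociativity is stated in C \ox (C \ox C). *)
Record is_coalgebra C (Delta : C -> C \ox C) (eps : C -> k) : Prop :=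
  IsCoalgebra {
  comul_linear : linear Delta;
  counit_linear : linear (eps : C -> k^o);
  comul_coassoc : forall c,
    \sw_(c1, c2 <- Delta c) \sw_(c11, c12 <- Delta c1) c11 \ot (c12 \ot c2)
    = \sw_(c1, c2 <- Delta c) c1 \ot Delta c2;
  counit_l : forall c, \sw_(c1, c2 <- Delta c) (eps c1 *: c2) = c;
  counit_r : forall c, \sw_(c1, c2 <- Delta c) (eps c2 *: c1) = c }.

Record is_coalgebra_map C D (DeltaC : C -> C \ox C) (epsC : C -> k)
    (DeltaD : D -> D \ox D) (epsD : D -> k) (f : C -> D) : Prop :=
  IsCoalgebraMap {
  coalgebra_map_linear : linear f;
  coalgebra_map_comul : forall c,
    DeltaD (f c) = \sw_(c1, c2 <- DeltaC c) f c1 \ot f c2;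
  coalgebra_map_counit : forall c, epsD (f c) = epsC c }.

Definition tensor_comul C D (DeltaC : C -> C \ox C) (DeltaD : D -> D \ox D)
    (t : C \ox D) : (C \ox D) \ox (C \ox D) :=
  \sw_(c, d <- t) \sw_(c1, c2 <- DeltaC c) \sw_(d1, d2 <- DeltaD d)
    ((c1 \ot d1) \ot (c2 \ot d2)).

Definition tensor_counit C D (epsC : C -> k) (epsD : D -> k) (t : C \ox D) : k :=
  tens_lift (fun c d => epsC c * epsD d : k^o) t.

Record is_hopf H (mul : H -> H -> H) (one : H) (Delta : H -> H \ox H)
    (eps : H -> k) (S : H -> H) : Prop := IsHopf {
  hopf_algebra : is_algebra mul one;
  hopf_coalgebra : is_coalgebra Delta eps;
  hopf_comulM : forall x y, Delta (mul x y) =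
    \sw_(x1, x2 <- Delta x) \sw_(y1, y2 <- Delta y) (mul x1 y1 \ot mul x2 y2);
  hopf_comul1 : Delta one = one \ot one;
  hopf_counitM : forall x y, eps (mul x y) = eps x * eps y;
  hopf_counit1 : eps one = 1;
  antipode_linear : linear S;
  antipode_l : forall x, \sw_(x1, x2 <- Delta x) mul (S x1) x2 = eps x *: one;
  antipode_r : forall x, \sw_(x1, x2 <- Delta x) mul x1 (S x2) = eps x *: one }.

Definition cocommutative C (Delta : C -> C \ox C) : Prop :=
  forall c, \sw_(c1, c2 <- Delta c) c2 \ot c1 = Delta c.

Record is_hopf_brace H (Delta : H -> H \ox H) (eps : H -> k)
    (mul : H -> H -> H) (one : H) (S : H -> H)
    (circ : H -> H -> H) (one_circ : H) (T : H -> H) : Prop := IsHopfBrace {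
  brace_hopf : is_hopf mul one Delta eps S;
  brace_hopf_circ : is_hopf circ one_circ Delta eps T;
  brace_compat : forall x y z, circ x (mul y z) =
    \sw_(x1, x' <- Delta x) \sw_(x2, x3 <- Delta x')
      mul (mul (circ x1 y) (S x2)) (circ x3 z) }.

Record is_left_module H (mul : H -> H -> H) (one : H) M (act : H -> M -> M)
    : Prop := IsLeftModule {
  lact_bilin : bilin act;
  lact_1 : forall m, act one m = m;
  lact_mul : forall x y m, act (mul x y) m = act x (act y m) }.

Record is_right_module A (mul : A -> A -> A) (one : A) M (act : M -> A -> M)
    : Prop := IsRightModule {
  ract_bilin : bilin act;
  ract_1 : forall m, act m one = m;
  ract_mul : forall m a b, act m (mul a b) = act (act m a) b }.

Record is_module_algebra H (mulH : H -> H -> H) (oneH : H)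
    (DeltaH : H -> H \ox H) (epsH : H -> k)
    A (mulA : A -> A -> A) (oneA : A) (act : H -> A -> A) : Prop :=
  IsModuleAlgebra {
  module_algebra_module : is_left_module mulH oneH act;
  module_algebra_mul : forall x a b, act x (mulA a b) =
    \sw_(x1, x2 <- DeltaH x) mulA (act x1 a) (act x2 b);
  module_algebra_one : forall x, act x oneA = epsH x *: oneA }.

(* [lact] is the left action of H on A, [ract] the right action of A on H. *)
Record is_matched_pair A (mulA : A -> A -> A) (oneA : A)
    (DeltaA : A -> A \ox A) (epsA : A -> k)
    H (mulH : H -> H -> H) (oneH : H) (DeltaH : H -> H \ox H) (epsH : H -> k)
    (lact : H -> A -> A) (ract : H -> A -> H) : Prop := IsMatchedPair {
  mp_lmodule : is_left_module mulH oneH lact;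
  mp_lcoalgebra : is_coalgebra_map (tensor_comul DeltaH DeltaA)
    (tensor_counit epsH epsA) DeltaA epsA (tens_lift lact);
  mp_rmodule : is_right_module mulA oneA ract;
  mp_rcoalgebra : is_coalgebra_map (tensor_comul DeltaH DeltaA)
    (tensor_counit epsH epsA) DeltaH epsH (tens_lift ract);
  mp_lact_one : forall x, lact x oneA = epsH x *: oneA;
  mp_ract_one : forall a, ract oneH a = epsA a *: oneH;
  mp_lact_mul : forall x a b, lact x (mulA a b) =
    \sw_(x1, x2 <- DeltaH x) \sw_(a1, a2 <- DeltaA a)
      mulA (lact x1 a1) (lact (ract x2 a2) b);
  mp_ract_mul : forall x y a, ract (mulH x y) a =
    \sw_(y1, y2 <- DeltaH y) \sw_(a1, a2 <- DeltaA a)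
      mulH (ract x (lact y1 a1)) (ract y2 a2);
  mp_compat : forall x a,
    \sw_(x1, x2 <- DeltaH x) \sw_(a1, a2 <- DeltaA a)
      ract x1 a1 \ot lact x2 a2
    = \sw_(x1, x2 <- DeltaH x) \sw_(a1, a2 <- DeltaA a)
      ract x2 a2 \ot lact x1 a1 }.

Definition tensor_mul A H (mulA : A -> A -> A) (mulH : H -> H -> H)
    (s t : A \ox H) : A \ox H :=
  \sw_(a, x <- s) \sw_(b, y <- t) mulA a b \ot mulH x y.

Definition bicrossed_mul A H (circ : A -> A -> A) (DeltaA : A -> A \ox A)
    (mulH : H -> H -> H) (DeltaH : H -> H \ox H)
    (lact : H -> A -> A) (ract : H -> A -> H) (s t : A \ox H) : A \ox H :=
  \sw_(a, x <- s) \sw_(b, y <- t)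
    \sw_(x1, x2 <- DeltaH x) \sw_(b1, b2 <- DeltaA b)
      circ a (lact x1 b1) \ot mulH (ract x2 b2) y.

End Structures.

Section PureTensors.
Variable k : fieldType.
Implicit Types A C D H U V W X : lmodType k.

Lemma linear_sw U V W X (F : U -> V -> W -> X) (t : V \ox W) :
  (forall v w, linear (fun u => F u v w)) ->
  linear (fun u => \sw_(v, w <- t) F u v w).
Proof.
move=> Fl a u u'; rewrite /tens_lift scaler_sumr -big_split /=.
by apply: eq_bigr => p _; apply: Fl.
Qed.

Lemma linear_funcomp U V W (g : V -> W) (f : U -> V) :
  linear g -> linear f -> linear (fun u => g (f u)).
Proof. by move=> gl fl a u u'; rewrite fl gl. Qed.

Lemma linear_tensl U V W (f : U -> V) (w : W) :
  linear f -> linear (fun u => f u \ot w).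
Proof. by move=> fl a u u'; rewrite fl (tens_bilin _ _).2. Qed.

Lemma linear_tensr U V W (f : U -> W) (v : V) :
  linear f -> linear (fun u => v \ot f u).
Proof. by move=> fl a u u'; rewrite fl (tens_bilin _ _).1. Qed.

Lemma linear_lift U V W X (f : U -> V \ox W) (F : V -> W -> X) :
  bilin F -> linear f -> linear (fun u => \sw_(v, w <- f u) F v w).
Proof. by move=> Fb; apply: linear_funcomp; apply: tens_lift_linear. Qed.

Lemma tensor_comul_tens C D (DeltaC : C -> C \ox C) (DeltaD : D -> D \ox D)
    (c : C) (d : D) : linear DeltaC -> linear DeltaD ->
  tensor_comul DeltaC DeltaD (c \ot d) =
  \sw_(c1, c2 <- DeltaC c) \sw_(d1, d2 <- DeltaD d)
    ((c1 \ot d1) \ot (c2 \ot d2)).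
Proof.
move=> lC lD; have lid V : linear (@id V) by [].
apply: (@tens_lift_tens _ _ _ _
  (fun c d => \sw_(c1, c2 <- DeltaC c) \sw_(d1, d2 <- DeltaD d)
    ((c1 \ot d1) \ot (c2 \ot d2)))).
split=> [c'|d'].
  apply: linear_sw => c1 c2; apply: linear_lift lD.
  split=> [d1|d2]; first by apply/linear_tensr/linear_tensr.
  by apply/linear_tensl/linear_tensr.
apply: linear_lift lC; split=> [c1|c2]; apply: linear_sw => d1 d2.
  by apply/linear_tensr/linear_tensl.
by apply/linear_tensl/linear_tensl.
Qed.

Lemma tensor_counit_tens C D (epsC : C -> k) (epsD : D -> k) (c : C) (d : D) :
  linear (epsC : C -> k^o) -> linear (epsD : D -> k^o) ->
  tensor_counit epsC epsD (c \ot d) = epsC c * epsD d.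
Proof.
move=> lC lD; apply: (@tens_lift_tens _ _ _ _ (fun c d => epsC c * epsD d : k^o)).
split=> [c'|d'] a u v /=.
  by rewrite lD mulrDr /GRing.scale /= mulrCA.
by rewrite lC mulrDl /GRing.scale /= mulrA.
Qed.

Lemma tensor_mul_tens A H (mulA : A -> A -> A) (mulH : H -> H -> H)
    (a b : A) (x y : H) : bilin mulA -> bilin mulH ->
  tensor_mul mulA mulH (a \ot x) (b \ot y) = mulA a b \ot mulH x y.
Proof.
move=> [mAr mAl] [mHr mHl].
rewrite /tensor_mul (tens_lift_tens (f := fun a x => _)).
  rewrite (tens_lift_tens (f := fun b y => _)) //.
  split=> ?; first exact/linear_tensr.
  exact: (linear_tensl (f := mulA a)).
split=> ?; apply: linear_sw => ? ?; first exact/linear_tensr/mHl.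
exact/linear_tensl/mAl.
Qed.

Lemma bicrossed_mul_tens A H (circ : A -> A -> A) (DeltaA : A -> A \ox A)
    (mulH : H -> H -> H) (DeltaH : H -> H \ox H)
    (lact : H -> A -> A) (ract : H -> A -> H) (a b : A) (x y : H) :
  bilin circ -> bilin mulH -> linear DeltaA -> linear DeltaH ->
  bilin lact -> bilin ract ->
  bicrossed_mul circ DeltaA mulH DeltaH lact ract (a \ot x) (b \ot y) =
  \sw_(x1, x2 <- DeltaH x) \sw_(b1, b2 <- DeltaA b)
    circ a (lact x1 b1) \ot mulH (ract x2 b2) y.
Proof.
move=> [cr cl] [mr ml] lA lH [lr ll] [rr rl].
have inb x1 x2 a' y' : bilin (fun b1 b2 =>
    circ a' (lact x1 b1) \ot mulH (ract x2 b2) y').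
  split=> ?; first exact/linear_tensr/(linear_funcomp (ml _))/rr.
  exact/linear_tensl/(linear_funcomp (cr _))/lr.
have inx a' b' y' : bilin (fun x1 x2 => \sw_(b1, b2 <- DeltaA b')
    circ a' (lact x1 b1) \ot mulH (ract x2 b2) y').
  split=> ?; apply: linear_sw => ? ?.
    exact/linear_tensr/(linear_funcomp (ml _))/rl.
  exact/linear_tensl/(linear_funcomp (cr _))/ll.
rewrite /bicrossed_mul (tens_lift_tens (f := fun a x => _)).
  rewrite (tens_lift_tens (f := fun b y => _)) //.
  split=> ?.
    by apply: linear_sw => ? ?; apply: linear_sw => ? ?; apply/linear_tensr/mr.
  by apply: linear_sw => ? ?; apply: linear_lift lA; apply: inb.
split=> ?; apply: linear_sw => ? ?.
  by apply: linear_lift lH; apply: inx.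
by apply: linear_sw => ? ?; apply: linear_sw => ? ?; apply/linear_tensl/cl.
Qed.

End PureTensors.

(* Main.v *)
(* With d running over the coalgebra H \ox A and L, R : H \ox A -> A, H the
   coalgebra maps induced by the two actions, the second product reads
     (a (x) x) o (b (x) y) = a o L d_(1) (x) R d_(2) y,   d = x (x) b,
   so its associativity is coassociativity for d, and its compatibility with
   the coproduct is the matched pair condition
   R d_(1) (x) L d_(2) = R d_(2) (x) L d_(1).  Its antipode sends a (x) x to
   (1 (x) S x) o (T a (x) 1).
   In the brace identity the module algebra axiom, the brace identity of A and
   the hypothesis on x <| (a a') expand both sides into the same expression in
   five legs of x, up to a permutation of the legs, which cocommutativity of H
   allows, and of the factors in H, which commutativity allows. *)

Require Import Defs.
From HB Require Import structures.
From mathcomp Require Import all_boot all_algebra.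

Set Implicit Arguments.
Unset Strict Implicit.
Unset Printing Implicit Defensive.

Import GRing.Theory.
Local Open Scope ring_scope.
Local Open Scope tensor_scope.

(** * Closure properties of linear maps *)

Section Multilinear.
Variable k : fieldType.
Implicit Types U V W X Y C D : lmodType k.

Lemma linear_bilinl U V W X (m : V -> W -> X) (f : U -> V) (w : W) :
  bilin m -> linear f -> linear (fun u => m (f u) w).
Proof. by move=> [_ ml] fl a u v; rewrite fl ml. Qed.

Lemma linear_bilinr U V W X (m : V -> W -> X) (f : U -> W) (v : V) :
  bilin m -> linear f -> linear (fun u => m v (f u)).
Proof. by move=> [mr _] fl a u u'; rewrite fl mr. Qed.

Lemma linear_scalel U V (f : U -> k^o) (v : V) :
  linear f -> linear (fun u => f u *: v).
Proof. by move=> fl a u u'; rewrite fl scalerDl -scalerA. Qed.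

Lemma linear_scaler U V (f : U -> V) (a : k) :
  linear f -> linear (fun u => a *: f u).
Proof. by move=> fl b u u'; rewrite fl scalerDr !scalerA mulrC. Qed.

Lemma linear_mull U (f : U -> k^o) (b : k) :
  linear f -> linear (fun u => f u * b : k^o).
Proof. by move=> fl a u u'; rewrite fl mulrDl /GRing.scale /= mulrA. Qed.

Lemma linear_mulr U (f : U -> k^o) (b : k) :
  linear f -> linear (fun u => b * f u : k^o).
Proof. by move=> fl a u u'; rewrite fl mulrDr /GRing.scale /= mulrCA. Qed.

Lemma linear_idfun V : linear (fun v : V => v).
Proof. by []. Qed.

End Multilinear.

(* Proves [linear f] and [bilin f] for multilinear expressions, from the
   (bi)linearity facts found in the context.  It does not unfold definitions. *)
Ltac mlin := cbn beta;
  lazymatch goal with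
  | |- bilin _ => first [ assumption | split; intro; mlin ]
  | |- forall _, _ => intro; mlin
  | |- _ =>
  match goal with
  | |- GRing.linear_for _ (fun u => u) => apply: linear_idfun
  | |- GRing.linear_for _ _ => assumption
  | h : _ |- GRing.linear_for _ _ => apply h
  | |- GRing.linear_for _ (fun u => tens_lift (@?F u) ?t) =>
      apply: linear_sw; mlin
  | |- GRing.linear_for _ (fun u => tens_lift ?F (@?f u)) =>
      apply: linear_lift; mlin
  | |- GRing.linear_for _ (fun u => tens (@?f u) ?w) =>
      apply: linear_tensl; mlin
  | |- GRing.linear_for _ (fun u => tens ?v (@?f u)) =>
      apply: linear_tensr; mlin
  | |- GRing.linear_for _ (fun u => @?f u *: ?w) =>
      apply: linear_scalel; mlin
  | |- GRing.linear_for _ (fun u => ?a *: @?f u) =>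
      apply: linear_scaler; mlin
  | |- GRing.linear_for _ (fun u => @?f u * ?w) =>
      apply: linear_mull; mlin
  | |- GRing.linear_for _ (fun u => ?a * @?f u) =>
      apply: linear_mulr; mlin
  | h : bilin ?m |- GRing.linear_for _ (fun u => ?m (@?f u) ?b) =>
      apply: (linear_bilinl _ h); mlin
  | h : bilin ?m |- GRing.linear_for _ (fun u => ?m ?b (@?f u)) =>
      apply: (linear_bilinr _ h); mlin
  | h : bilin ?m |- GRing.linear_for _ (?m ?b) => apply: h.1
  | h : GRing.linear_for _ ?g |- GRing.linear_for _ (fun u => ?g (@?f u)) =>
      apply: (linear_funcomp h); mlin
  | |- GRing.linear_for _ ?f =>
      lazymatch f with
      | fun _ => _ => fail
      | _ => change (linear (fun u => f u)); mlin
      end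
  end
  end.

(** * Calculus of Sweedler sums, for vector spaces and for coalgebras *)

Section Sweedler.
Variable k : fieldType.
Implicit Types U V W X Y C D : lmodType k.

(** Both sides sum over the same chosen representative of [t], so the terms can be compared one by
    one. *)
Lemma eq_sw V W U (F G : V -> W -> U) (t : V \ox W) :
  (forall v w, F v w = G v w) -> tens_lift F t = tens_lift G t.
Proof. by move=> FG; apply: eq_bigr => p _. Qed.

Lemma linear_zero U X (g : U -> X) : linear g -> g 0 = 0.
Proof. by move=> /(_ (-1) 0 0); rewrite scaler0 addr0 scaleN1r addNr. Qed.

Lemma linear_of_scale U X (g : U -> X) (a : k) (u : U) :
  linear g -> g (a *: u) = a *: g u.
Proof. by move=> gl; have := gl a u 0; rewrite (linear_zero gl) !addr0. Qed.

Lemma linear_of_sw V W U X (g : U -> X) (F : V -> W -> U) (t : V \ox W) :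
  linear g -> g (tens_lift F t) = \sw_(v, w <- t) g (F v w).
Proof.
move=> gl; apply: (big_morph g) => [u v|]; last exact: linear_zero.
by have := gl 1 u v; rewrite !scale1r.
Qed.

Lemma exchange_sw V W X Y U (F : V -> W -> X -> Y -> U) (s : V \ox W)
    (t : X \ox Y) :
  \sw_(v, w <- s) \sw_(x, y <- t) F v w x y
  = \sw_(x, y <- t) \sw_(v, w <- s) F v w x y.
Proof. exact: exchange_big. Qed.

(** The map induced by the bilinear [F] is linear, so it passes through the outer sum whatever
    representative is chosen for the total tensor. *)
Lemma sw_sw V W X Y U (F : X -> Y -> U) (G : V -> W -> X \ox Y) (t : V \ox W) :
  bilin F ->
  \sw_(x, y <- \sw_(v, w <- t) G v w) F x y
  = \sw_(v, w <- t) \sw_(x, y <- G v w) F x y.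
Proof.
by move=> Fb; apply: (linear_of_sw (g := tens_lift F)); apply: tens_lift_linear.
Qed.

Lemma sw_bilinl V W U X Y (m : U -> X -> Y) (F : V -> W -> U) t b :
  bilin m -> m (tens_lift F t) b = \sw_(v, w <- t) m (F v w) b.
Proof. by move=> mb; apply: (linear_of_sw (g := m^~ b)); apply: mb.2. Qed.

Lemma sw_bilinr V W U X Y (m : X -> U -> Y) (F : V -> W -> U) t b :
  bilin m -> m b (tens_lift F t) = \sw_(v, w <- t) m b (F v w).
Proof. by move=> mb; apply: linear_of_sw; apply: mb.1. Qed.

(** A linear map on a tensor product is the one induced by its values on pure tensors. This reduces
    the Hopf axioms below to pure tensors. *)
Lemma eq_on_tens V W U (f g : V \ox W -> U) :
  linear f -> linear g -> (forall v w, f (v \ot w) = g (v \ot w)) -> f =1 g.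
Proof.
move=> fl gl fg t.
have b : bilin (fun v w => g (v \ot w)) by mlin.
by rewrite (tens_lift_unique b fl fg) (tens_lift_unique b gl).
Qed.

Lemma sw_tens V W U (F : V -> W -> U) (v : V) (w : W) :
  bilin F -> \sw_(x, y <- v \ot w) F x y = F v w.
Proof. by move=> Fb; rewrite tens_lift_tens. Qed.

Lemma tens_scalel V W a (v : V) (w : W) : (a *: v) \ot w = a *: (v \ot w).
Proof. by apply: (linear_of_scale (g := fun v => v \ot w)); mlin. Qed.

Lemma tens_scaler V W a (v : V) (w : W) : v \ot (a *: w) = a *: (v \ot w).
Proof. by apply: linear_of_scale; mlin. Qed.

Section Coalgebra.
Variables (C : lmodType k) (Delta : C -> C \ox C) (eps : C -> k).
Hypothesis hC : is_coalgebra Delta eps.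
Variable U : lmodType k.

(** The trilinear [F] induces a linear map [g] on [C \ox (C \ox C)]; applying [g] to the
    coassociativity axiom gives the claim. *)
Lemma sw_coassoc (F : C -> C -> C -> U) :
  (forall b c, linear (fun a => F a b c)) ->
  (forall a c, linear (fun b => F a b c)) ->
  (forall a b, linear (fun c => F a b c)) ->
  forall x,
  \sw_(x', x3 <- Delta x) \sw_(x1, x2 <- Delta x') F x1 x2 x3
  = \sw_(x1, x' <- Delta x) \sw_(x2, x3 <- Delta x') F x1 x2 x3.
Proof.
move=> F1 F2 F3 x.
pose g (t : C \ox (C \ox C)) := \sw_(a, t' <- t) \sw_(b, c <- t') F a b c.
have gb : bilin (fun a t1 => \sw_(b, c <- t1) F a b c) by mlin.
have gl : linear g by rewrite /g; mlin.
have gE a t : g (a \ot t) = \sw_(b, c <- t) F a b c by rewrite /g sw_tens.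
have := congr1 g (comul_coassoc hC x); rewrite !(linear_of_sw _ _ gl).
under eq_sw => a b do rewrite (linear_of_sw _ _ gl).
under eq_sw => a b do under eq_sw => c d do (rewrite gE sw_tens; last by mlin).
by move=> ->; apply: eq_sw => a b; rewrite gE.
Qed.

(** Rebracketing puts the two middle legs into one coproduct, where an identity about a single
    coproduct can exchange them. *)
Lemma sw_coassoc_middle (F : C -> C -> C -> C -> U) :
  (forall b c d, linear (fun a => F a b c d)) ->
  (forall a c d, linear (fun b => F a b c d)) ->
  (forall a b d, linear (fun c => F a b c d)) ->
  (forall a b c, linear (fun d => F a b c d)) ->
  forall x,
  \sw_(x', x'' <- Delta x) \sw_(x1, x2 <- Delta x')
    \sw_(x3, x4 <- Delta x'') F x1 x2 x3 x4
  = \sw_(x1, x' <- Delta x) \sw_(x'', x4 <- Delta x')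
      \sw_(x2, x3 <- Delta x'') F x1 x2 x3 x4.
Proof.
have lD : linear Delta := comul_linear hC.
move=> F1 F2 F3 F4 x.
rewrite (sw_coassoc (F := fun _ _ _ => _)); [ | by mlin..].
by apply: eq_sw => x1 x'; rewrite sw_coassoc.
Qed.

Lemma sw_counitl (f : C -> U) x :
  linear f -> \sw_(x1, x2 <- Delta x) (eps x1 *: f x2) = f x.
Proof.
move=> fl; rewrite -{2}(counit_l hC x) (linear_of_sw _ _ fl).
by apply: eq_sw => a b; rewrite linear_of_scale.
Qed.

Lemma sw_counitr (f : C -> U) x :
  linear f -> \sw_(x1, x2 <- Delta x) (eps x2 *: f x1) = f x.
Proof.
move=> fl; rewrite -{2}(counit_r hC x) (linear_of_sw _ _ fl).
by apply: eq_sw => a b; rewrite linear_of_scale.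
Qed.

Lemma sw_cocomm (F : C -> C -> U) x : cocommutative Delta -> bilin F ->
  \sw_(x1, x2 <- Delta x) F x1 x2 = \sw_(x1, x2 <- Delta x) F x2 x1.
Proof.
move=> coc Fb; rewrite -{1}coc sw_sw //.
by apply: eq_sw => a b; rewrite sw_tens.
Qed.

(** Coassociativity turns the first two legs into those of one coproduct, which cocommutativity
    swaps. *)
Lemma sw_cocomm12 (F : C -> C -> C -> U) x : cocommutative Delta ->
  (forall b c, linear (fun a => F a b c)) ->
  (forall a c, linear (fun b => F a b c)) ->
  (forall a b, linear (fun c => F a b c)) ->
  \sw_(x1, x' <- Delta x) \sw_(x2, x3 <- Delta x') F x1 x2 x3
  = \sw_(x1, x' <- Delta x) \sw_(x2, x3 <- Delta x') F x2 x1 x3.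
Proof.
move=> coc F1 F2 F3; rewrite -sw_coassoc //.
rewrite -(sw_coassoc (F := fun a b c => F b a c)) //.
by apply: eq_sw => x' x3; rewrite sw_cocomm; last by mlin.
Qed.

(** This is the permutation of the legs of [x] by which the two sides of the final brace identity
    differ. *)
Lemma sw_cocomm_move (F : C -> C -> C -> C -> C -> U) x : cocommutative Delta ->
  (forall b c d e, linear (fun a => F a b c d e)) ->
  (forall a c d e, linear (fun b => F a b c d e)) ->
  (forall a b d e, linear (fun c => F a b c d e)) ->
  (forall a b c e, linear (fun d => F a b c d e)) ->
  (forall a b c d, linear (fun e => F a b c d e)) ->
  \sw_(x', x'' <- Delta x) \sw_(x1, x2 <- Delta x')
    \sw_(x3, y <- Delta x'') \sw_(x4, x5 <- Delta y) F x1 x2 x3 x4 x5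
  = \sw_(x', x'' <- Delta x) \sw_(x1, x2 <- Delta x')
    \sw_(x3, y <- Delta x'') \sw_(x4, x5 <- Delta y) F x1 x3 x4 x2 x5.
Proof.
have lD : linear Delta := comul_linear hC.
move=> coc F1 F2 F3 F4 F5.
rewrite [LHS](sw_coassoc (F := fun _ _ _ => _)); [ | by mlin..].
rewrite [RHS](sw_coassoc (F := fun _ _ _ => _)); [ | by mlin..].
apply: eq_sw => x1 x'.
(* The middle slots hold legs 3, 4, 2; swapping legs 2 and 3, then legs 3 and 4, restores the
   order. *)
rewrite [RHS](sw_cocomm12 (F := fun _ _ _ => _)) //; [ | by mlin..].
apply: eq_sw => x2 x''.
by rewrite [RHS](sw_cocomm12 (F := fun _ _ _ => _)) //; mlin.
Qed.

End Coalgebra.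
End Sweedler.

(** * The tensor product of two coalgebras *)

Section TensorCoalgebra.
Variables (k : fieldType) (C D : lmodType k).
Variables (DeltaC : C -> C \ox C) (epsC : C -> k).
Variables (DeltaD : D -> D \ox D) (epsD : D -> k).
Hypothesis hC : is_coalgebra DeltaC epsC.
Hypothesis hD : is_coalgebra DeltaD epsD.
Let lC : linear DeltaC := comul_linear hC.
Let lD : linear DeltaD := comul_linear hD.
Let leC : linear (epsC : C -> k^o) := counit_linear hC.
Let leD : linear (epsD : D -> k^o) := counit_linear hD.
Local Notation Delta := (tensor_comul DeltaC DeltaD).
Local Notation eps := (tensor_counit epsC epsD).

Lemma tensor_comul_linear : linear Delta.
Proof. by rewrite /tensor_comul; mlin. Qed.
Let lCD := tensor_comul_linear.

Lemma tensor_counit_linear : linear (eps : C \ox D -> k^o).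
Proof. by rewrite /tensor_counit; mlin. Qed.
Let leCD := tensor_counit_linear.

Lemma sw_tensor_comul (U : lmodType k) (F : C \ox D -> C \ox D -> U) c d :
  bilin F ->
  \sw_(s, t <- Delta (c \ot d)) F s t
  = \sw_(c1, c2 <- DeltaC c) \sw_(d1, d2 <- DeltaD d)
      F (c1 \ot d1) (c2 \ot d2).
Proof.
move=> Fb; rewrite tensor_comul_tens // sw_sw //; apply: eq_sw => c1 c2.
by rewrite sw_sw //; apply: eq_sw => d1 d2; rewrite sw_tens.
Qed.

Lemma tensor_coalgebra : is_coalgebra Delta eps.
Proof.
split=> //.
- apply: eq_on_tens; [by mlin | by mlin | move=> c d].
  rewrite sw_tensor_comul; last by mlin.
  under eq_sw => c1 c2 do under eq_sw => d1 d2 do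
    (rewrite sw_tensor_comul; last by mlin).
  (* The exchange makes the two coproducts of [c] adjacent, so that coassociativity applies in [C]
     and then in [D]. *)
  under eq_sw => c1 c2 do rewrite exchange_sw.
  rewrite (sw_coassoc hC (F := fun _ _ _ => _)); [ | by mlin..].
  under eq_sw => c1 c2 do under eq_sw => d1 d2 do
    (rewrite (sw_coassoc hD (F := fun _ _ _ => _)); [ | by mlin..]).
  rewrite sw_tensor_comul; last by mlin.
  apply: eq_sw => c1 c2; rewrite exchange_sw; apply: eq_sw => d1 d2.
  rewrite tensor_comul_tens // sw_bilinr; last by mlin.
  by apply: eq_sw => c3 c4; rewrite sw_bilinr; last by mlin.
- apply: eq_on_tens; [by mlin | by mlin | move=> c d].
  rewrite sw_tensor_comul; last by mlin.
  (* The counit laws of [C] and [D] expand the right-hand side into the double sum on the left. *)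
  rewrite -(sw_counitl hC c (f := fun c => c \ot d)); last by mlin.
  apply: eq_sw => c1 c2.
  rewrite -(sw_counitl hD d (f := fun d => epsC c1 *: (c2 \ot d))); last by mlin.
  apply: eq_sw => d1 d2.
  by rewrite tensor_counit_tens // mulrC scalerA.
- apply: eq_on_tens; [by mlin | by mlin | move=> c d].
  rewrite sw_tensor_comul; last by mlin.
  rewrite -(sw_counitr hC c (f := fun c => c \ot d)); last by mlin.
  apply: eq_sw => c1 c2.
  rewrite -(sw_counitr hD d (f := fun d => epsC c2 *: (c1 \ot d))); last by mlin.
  apply: eq_sw => d1 d2.
  by rewrite tensor_counit_tens // mulrC scalerA.
Qed.

End TensorCoalgebra.

(** * The tensor product of two Hopf algebras *)

Lemma eq_on_tens2 (k : fieldType) (V W X Y U : lmodType k)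
    (f g : V \ox W -> X \ox Y -> U) : bilin f -> bilin g ->
  (forall v w x y, f (v \ot w) (x \ot y) = g (v \ot w) (x \ot y)) ->
  forall s t, f s t = g s t.
Proof.
move=> fb gb fg s t; move: s; apply: eq_on_tens; [by mlin | by mlin |].
by move=> v w; move: t; apply: eq_on_tens; [by mlin | by mlin |].
Qed.

Lemma sw_comulM (k : fieldType) (H U : lmodType k) (mul : H -> H -> H)
    (one : H) (Delta : H -> H \ox H) (eps : H -> k) (S : H -> H)
    (F : H -> H -> U) x y : is_hopf mul one Delta eps S -> bilin F ->
  \sw_(u, v <- Delta (mul x y)) F u v
  = \sw_(x1, x2 <- Delta x) \sw_(y1, y2 <- Delta y) F (mul x1 y1) (mul x2 y2).
Proof.
move=> hH Fb; rewrite (hopf_comulM hH) sw_sw //; apply: eq_sw => x1 x2.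
by rewrite sw_sw //; apply: eq_sw => y1 y2; rewrite sw_tens.
Qed.

Section TensorHopf.
Variables (k : fieldType) (A H : lmodType k).
Variables (mulA : A -> A -> A) (oneA : A) (DeltaA : A -> A \ox A).
Variables (epsA : A -> k) (SA : A -> A).
Variables (mulH : H -> H -> H) (oneH : H) (DeltaH : H -> H \ox H).
Variables (epsH : H -> k) (SH : H -> H).
Hypothesis hA : is_hopf mulA oneA DeltaA epsA SA.
Hypothesis hH : is_hopf mulH oneH DeltaH epsH SH.

Let cA := hopf_coalgebra hA.
Let cH := hopf_coalgebra hH.
Let mA : bilin mulA := mul_bilin (hopf_algebra hA).
Let mH : bilin mulH := mul_bilin (hopf_algebra hH).
Let lA : linear DeltaA := comul_linear cA.
Let lH : linear DeltaH := comul_linear cH.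
Let eA : linear (epsA : A -> k^o) := counit_linear cA.
Let eH : linear (epsH : H -> k^o) := counit_linear cH.
Let sA : linear SA := antipode_linear hA.
Let sH : linear SH := antipode_linear hH.
Local Notation Delta := (tensor_comul DeltaA DeltaH).
Local Notation eps := (tensor_counit epsA epsH).
Local Notation mul := (tensor_mul mulA mulH).
Let lAH : linear Delta := tensor_comul_linear cA cH.
Let eAH : linear (eps : A \ox H -> k^o) := tensor_counit_linear cA cH.

Lemma tensor_mul_bilin : bilin mul.
Proof. by rewrite /tensor_mul; mlin. Qed.
Let mAH := tensor_mul_bilin.

Definition tensor_antipode (t : A \ox H) : A \ox H :=
  \sw_(a, x <- t) SA a \ot SH x.

Lemma tensor_antipode_tens a x : tensor_antipode (a \ot x) = SA a \ot SH x.
Proof. by rewrite /tensor_antipode sw_tens; last by mlin. Qed.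

Lemma tensor_antipode_linear : linear tensor_antipode.
Proof. by rewrite /tensor_antipode; mlin. Qed.
Let sAH := tensor_antipode_linear.

Lemma tensor_algebra : is_algebra mul (oneA \ot oneH).
Proof.
split=> //.
- move=> r s t; move: r; apply: eq_on_tens; [by mlin | by mlin | move=> a x].
  move: s t; apply: eq_on_tens2; [by mlin | by mlin | move=> b y c z].
  by rewrite !tensor_mul_tens // (mul_assoc (hopf_algebra hA))
             (mul_assoc (hopf_algebra hH)).
- apply: eq_on_tens; [by mlin | by mlin | move=> a x].
  by rewrite tensor_mul_tens // (mul_1l (hopf_algebra hA))
             (mul_1l (hopf_algebra hH)).
- apply: eq_on_tens; [by mlin | by mlin | move=> a x].
  by rewrite tensor_mul_tens // (mul_1r (hopf_algebra hA))
             (mul_1r (hopf_algebra hH)).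
Qed.

Lemma tensor_hopf : is_hopf mul (oneA \ot oneH) Delta eps tensor_antipode.
Proof.
split=> //; first exact: tensor_algebra; first exact: tensor_coalgebra.
- apply: eq_on_tens2; [by mlin | by mlin | move=> a x b y].
  rewrite tensor_mul_tens // tensor_comul_tens //.
  rewrite (sw_comulM _ _ hA); last by mlin.
  rewrite (sw_tensor_comul cA cH); last by mlin.
  apply: eq_sw => a1 a2.
  under [RHS]eq_sw => x1 x2 do (rewrite (sw_tensor_comul cA cH); last by mlin).
  rewrite [RHS]exchange_sw; apply: eq_sw => b1 b2.
  rewrite (sw_comulM _ _ hH); last by mlin.
  by do 2!apply: eq_sw => ? ?; rewrite !tensor_mul_tens.
- rewrite tensor_comul_tens // (hopf_comul1 hA) sw_tens; last by mlin.
  by rewrite (hopf_comul1 hH) sw_tens; last by mlin.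
- apply: (eq_on_tens2 (U := k^o)); [by mlin | by mlin | move=> a x b y].
  rewrite tensor_mul_tens // !tensor_counit_tens // (hopf_counitM hA).
  by rewrite (hopf_counitM hH) mulrACA.
- by rewrite tensor_counit_tens // (hopf_counit1 hA) (hopf_counit1 hH) mulr1.
- apply: eq_on_tens; [by mlin | by mlin | move=> a x].
  rewrite (sw_tensor_comul cA cH); last by mlin.
  rewrite tensor_counit_tens // -scalerA.
  under eq_sw => a1 a2 do under eq_sw => x1 x2 do
    rewrite tensor_antipode_tens tensor_mul_tens //.
  (* Each sum concerns one tensor factor only; folded back into its factor, it is an antipode law of
     [A] or of [H]. *)
  under eq_sw => a1 a2 do (rewrite -sw_bilinr; last by mlin).
  rewrite -sw_bilinl; last by mlin.
  rewrite (antipode_l hA) (antipode_l hH).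
  by rewrite tens_scalel tens_scaler.
- apply: eq_on_tens; [by mlin | by mlin | move=> a x].
  rewrite (sw_tensor_comul cA cH); last by mlin.
  rewrite tensor_counit_tens // -scalerA.
  under eq_sw => a1 a2 do under eq_sw => x1 x2 do
    rewrite tensor_antipode_tens tensor_mul_tens //.
  under eq_sw => a1 a2 do (rewrite -sw_bilinr; last by mlin).
  rewrite -sw_bilinl; last by mlin.
  rewrite (antipode_r hA) (antipode_r hH).
  by rewrite tens_scalel tens_scaler.
Qed.

End TensorHopf.

(** * The bicrossed product Hopf algebra of a matched pair *)

Lemma sw_coalgebra_map (k : fieldType) (C D U : lmodType k)
    (DeltaC : C -> C \ox C) (epsC : C -> k) (DeltaD : D -> D \ox D)
    (epsD : D -> k) (f : C -> D) (F : D -> D -> U) c :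
  is_coalgebra_map DeltaC epsC DeltaD epsD f -> bilin F ->
  \sw_(d1, d2 <- DeltaD (f c)) F d1 d2
  = \sw_(c1, c2 <- DeltaC c) F (f c1) (f c2).
Proof.
move=> hf Fb; rewrite (coalgebra_map_comul hf) sw_sw //.
by apply: eq_sw => c1 c2; rewrite sw_tens.
Qed.

Section Bicrossed.
Variables (k : fieldType) (A H : lmodType k).
Variables (mulA : A -> A -> A) (oneA : A) (DeltaA : A -> A \ox A).
Variables (epsA : A -> k) (SA : A -> A).
Variables (mulH : H -> H -> H) (oneH : H) (DeltaH : H -> H \ox H).
Variables (epsH : H -> k) (SH : H -> H).
Variables (lact : H -> A -> A) (ract : H -> A -> H).
Hypothesis hA : is_hopf mulA oneA DeltaA epsA SA.
Hypothesis hH : is_hopf mulH oneH DeltaH epsH SH.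
Hypothesis hm : is_matched_pair mulA oneA DeltaA epsA
                                mulH oneH DeltaH epsH lact ract.

Let cA := hopf_coalgebra hA.
Let cH := hopf_coalgebra hH.
Let algA := hopf_algebra hA.
Let algH := hopf_algebra hH.
Let mA : bilin mulA := mul_bilin algA.
Let mH : bilin mulH := mul_bilin algH.
Let lA : linear DeltaA := comul_linear cA.
Let lH : linear DeltaH := comul_linear cH.
Let eA : linear (epsA : A -> k^o) := counit_linear cA.
Let eH : linear (epsH : H -> k^o) := counit_linear cH.
Let sA : linear SA := antipode_linear hA.
Let sH : linear SH := antipode_linear hH.
Let bl : bilin lact := lact_bilin (mp_lmodule hm).
Let br : bilin ract := ract_bilin (mp_rmodule hm).
Local Notation DeltaAH := (tensor_comul DeltaA DeltaH).
Local Notation epsAH := (tensor_counit epsA epsH).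
Local Notation DeltaHA := (tensor_comul DeltaH DeltaA).
Local Notation epsHA := (tensor_counit epsH epsA).
Local Notation mul := (bicrossed_mul mulA DeltaA mulH DeltaH lact ract).
Local Notation L := (tens_lift lact).
Local Notation R := (tens_lift ract).
Let lAH : linear DeltaAH := tensor_comul_linear cA cH.
Let eAH : linear (epsAH : A \ox H -> k^o) := tensor_counit_linear cA cH.
Let cHA := tensor_coalgebra cH cA.
Let lHA : linear DeltaHA := tensor_comul_linear cH cA.
Let eHA : linear (epsHA : H \ox A -> k^o) := tensor_counit_linear cH cA.
Let lL : linear L := coalgebra_map_linear (mp_lcoalgebra hm).
Let lR : linear R := coalgebra_map_linear (mp_rcoalgebra hm).

Lemma bicrossed_mul_bilin : bilin mul.
Proof. by rewrite /bicrossed_mul; mlin. Qed.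
Let mAH := bicrossed_mul_bilin.

(** The separate coproducts of [x] and [b] merge into one coproduct of [x \ot b], so that the
    coalgebra laws of [H \ox A] apply. The next two lemmas do the same for the matched pair
    axioms. *)
Lemma bicrossed_mul_sw a x b y : mul (a \ot x) (b \ot y) =
  \sw_(d1, d2 <- DeltaHA (x \ot b)) mulA a (L d1) \ot mulH (R d2) y.
Proof.
rewrite bicrossed_mul_tens // (sw_tensor_comul cH cA); last by mlin.
by do 2!apply: eq_sw => ? ?; rewrite !tens_lift_tens.
Qed.

Lemma lact_mulA x a b : lact x (mulA a b) =
  \sw_(d1, d2 <- DeltaHA (x \ot a)) mulA (L d1) (lact (R d2) b).
Proof.
rewrite (mp_lact_mul hm) (sw_tensor_comul cH cA); last by mlin.
by do 2!apply: eq_sw => ? ?; rewrite !tens_lift_tens.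
Qed.

Lemma ract_mulH x y a : ract (mulH x y) a =
  \sw_(d1, d2 <- DeltaHA (y \ot a)) mulH (ract x (L d1)) (R d2).
Proof.
rewrite (mp_ract_mul hm) (sw_tensor_comul cH cA); last by mlin.
by do 2!apply: eq_sw => ? ?; rewrite !tens_lift_tens.
Qed.

(** The compatibility axiom is composed with the map induced by [F] and extended from pure tensors
    to any [d], so that it can be used on inner legs of a longer coproduct. *)
Lemma sw_matched (U : lmodType k) (F : H -> A -> U) d : bilin F ->
  \sw_(d1, d2 <- DeltaHA d) F (R d1) (L d2)
  = \sw_(d1, d2 <- DeltaHA d) F (R d2) (L d1).
Proof.
move=> Fb; move: d; apply: eq_on_tens; [by mlin | by mlin | move=> x a].
have := congr1 (tens_lift F) (mp_compat hm x a).
rewrite !(sw_tensor_comul cH cA); [ | by mlin..].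
rewrite !sw_sw //.
under eq_sw => x1 x2.
  rewrite sw_sw //; under eq_sw => a1 a2 do rewrite sw_tens //.
  over.
under [RHS]eq_sw => x1 x2.
  rewrite sw_sw //; under eq_sw => a1 a2 do rewrite sw_tens //.
  over.
move=> E.
under eq_sw => x1 x2 do under eq_sw => a1 a2 do rewrite !tens_lift_tens //.
under [RHS]eq_sw => x1 x2 do under eq_sw => a1 a2 do rewrite !tens_lift_tens //.
exact: E.
Qed.

Lemma bicrossed_mulA : associative mul.
Proof.
move=> r s t; move: r; apply: eq_on_tens; [by mlin | by mlin | move=> a x].
move: s t; apply: eq_on_tens2; [by mlin | by mlin | move=> b y c z].
(* The common summand of both bracketings: the [d] are three legs of [x \ot b], the [e] three legs
   of [y \ot c]. *)
pose N d1 d2 d3 e1 e2 e3 :=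
  mulA a (mulA (L d1) (lact (R d2) (L e1)))
    \ot mulH (mulH (ract (R d3) (L e2)) (R e3)) z.
transitivity (\sw_(d', d3 <- DeltaHA (x \ot b)) \sw_(d1, d2 <- DeltaHA d')
  \sw_(e', e3 <- DeltaHA (y \ot c)) \sw_(e1, e2 <- DeltaHA e')
    N d1 d2 d3 e1 e2 e3).

(* Multiplying the last two factors first splits [d'] and [e'], the first legs, once more. *)
under eq_sw => d' d3 do rewrite exchange_sw.
rewrite exchange_sw bicrossed_mul_sw sw_bilinr //; apply: eq_sw => e' e3.
rewrite bicrossed_mul_tens //.
rewrite (sw_tensor_comul cH cA); last by rewrite /N; mlin.
apply: eq_sw => x1 x2; rewrite (sw_comulM _ _ hA); last by mlin.
apply: eq_sw => b1 b2.
rewrite (sw_coalgebra_map _ (mp_lcoalgebra hm)); last by mlin.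
rewrite exchange_sw; apply: eq_sw => e1 e2.
rewrite lact_mulA (ract_mul (mp_rmodule hm)) (sw_bilinr _ _ _ mA).
rewrite sw_bilinl; last by mlin.
apply: eq_sw => d1 d2.
by rewrite /N (mul_assoc algH) (tens_lift_tens br).
transitivity (\sw_(d1, d' <- DeltaHA (x \ot b)) \sw_(d2, d3 <- DeltaHA d')
  \sw_(e1, e' <- DeltaHA (y \ot c)) \sw_(e2, e3 <- DeltaHA e')
    N d1 d2 d3 e1 e2 e3).
  rewrite (sw_coassoc cHA (F := fun _ _ _ => _)); [ | by rewrite /N; mlin..].
  do 2!apply: eq_sw => ? ?.
  by rewrite (sw_coassoc cHA (F := fun _ _ _ => _)); [ | by rewrite /N; mlin..].
(* Multiplying the first two factors first splits the second legs instead; coassociativity has just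
   identified the two splittings. *)
rewrite bicrossed_mul_sw sw_bilinl //.
apply: eq_sw => d1 d'.
rewrite bicrossed_mul_tens // (sw_comulM _ _ hH); last by mlin.
rewrite (sw_coalgebra_map _ (mp_rcoalgebra hm)); last by mlin.
apply: eq_sw => d2 d3.
rewrite (sw_tensor_comul cH cA); last by rewrite /N; mlin.
apply: eq_sw => y1 y2; apply: eq_sw => c1 c2.
rewrite (lact_mul (mp_lmodule hm)) ract_mulH.
rewrite (sw_bilinl _ _ _ mH) sw_bilinr; last by mlin.
by apply: eq_sw => e1 e2; rewrite /N (tens_lift_tens bl) !(mul_assoc algA).
Qed.

(** [oneH] acts as the identity and is acted on through the counit, so the second leg of [b]
    disappears. With its mirror image below, this gives the units and the factorisation of
    [a \ot x]. *)
Lemma bicrossed_mul_onel b a x : mul (a \ot oneH) (b \ot x) = mulA a b \ot x.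
Proof.
rewrite bicrossed_mul_tens // (hopf_comul1 hH) sw_tens; last by mlin.
rewrite -(sw_counitr cA b (f := fun b => mulA a b \ot x)); last by mlin.
apply: eq_sw => b1 b2.
rewrite (lact_1 (mp_lmodule hm)) (mp_ract_one hm).
rewrite (linear_of_scale (g := mulH^~ x)); last by mlin.
by rewrite (mul_1l algH) tens_scaler.
Qed.

Lemma bicrossed_mul_oner y a x : mul (a \ot x) (oneA \ot y) = a \ot mulH x y.
Proof.
rewrite bicrossed_mul_tens // (hopf_comul1 hA).
rewrite -(sw_counitl cH x (f := fun x => a \ot mulH x y)); last by mlin.
apply: eq_sw => x1 x2; rewrite sw_tens; last by mlin.
rewrite (ract_1 (mp_rmodule hm)) (mp_lact_one hm).
rewrite linear_of_scale; last by mlin.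
by rewrite (mul_1r algA) tens_scalel.
Qed.

Lemma bicrossed_algebra : is_algebra mul (oneA \ot oneH).
Proof.
split=> //; first exact: bicrossed_mulA.
- apply: eq_on_tens; [by mlin | by mlin | move=> a x].
  by rewrite bicrossed_mul_onel (mul_1l algA).
- apply: eq_on_tens; [by mlin | by mlin | move=> a x].
  by rewrite bicrossed_mul_oner (mul_1r algH).
Qed.

Lemma bicrossed_comulM s t : DeltaAH (mul s t) =
  \sw_(s1, s2 <- DeltaAH s) \sw_(t1, t2 <- DeltaAH t) (mul s1 t1 \ot mul s2 t2).
Proof.
move: s t; apply: eq_on_tens2; [by mlin | by mlin | move=> a x b y].
(* Expanding the coproduct of the product feeds legs 1 and 2 to [L] and legs 3 and 4 to [R]. *)
transitivity (\sw_(a1, a2 <- DeltaA a) \sw_(y1, y2 <- DeltaH y)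
  \sw_(d', d'' <- DeltaHA (x \ot b)) \sw_(d1, d2 <- DeltaHA d')
  \sw_(d3, d4 <- DeltaHA d'')
    (mulA a1 (L d1) \ot mulH (R d3) y1) \ot
    (mulA a2 (L d2) \ot mulH (R d4) y2)).
  rewrite bicrossed_mul_sw linear_of_sw //.
  under [RHS]eq_sw => a1 a2 do rewrite exchange_sw.
  rewrite [RHS]exchange_sw; apply: eq_sw => d' d''.
  rewrite tensor_comul_tens // (sw_comulM _ _ hA); last by mlin.
  apply: eq_sw => a1 a2.
  rewrite (sw_coalgebra_map _ (mp_lcoalgebra hm)); last by mlin.
  rewrite [RHS]exchange_sw; apply: eq_sw => d1 d2.
  rewrite (sw_comulM _ _ hH); last by mlin.
  rewrite (sw_coalgebra_map _ (mp_rcoalgebra hm)); last by mlin.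
  by rewrite exchange_sw.
rewrite (sw_tensor_comul cA cH); last by mlin.
apply: eq_sw => a1 a2.
under [RHS]eq_sw => x1 x2 do (rewrite (sw_tensor_comul cA cH); last by mlin).
under [RHS]eq_sw => x1 x2 do rewrite exchange_sw.
rewrite [RHS]exchange_sw; apply: eq_sw => y1 y2.
(* The product of the coproducts feeds legs 1 and 3 to [L], legs 2 and 4 to [R]: the middle legs
   must trade places, which is the matched pair condition. *)
transitivity (\sw_(d', d'' <- DeltaHA (x \ot b)) \sw_(d1, d2 <- DeltaHA d')
  \sw_(d3, d4 <- DeltaHA d'')
    (mulA a1 (L d1) \ot mulH (R d2) y1) \ot
    (mulA a2 (L d3) \ot mulH (R d4) y2)).
  rewrite [LHS](sw_coassoc_middle cHA (F := fun _ _ _ _ => _)); [ | by mlin..].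
  rewrite [RHS](sw_coassoc_middle cHA (F := fun _ _ _ _ => _)); [ | by mlin..].
  apply: eq_sw => d1 d'; apply: eq_sw => d'' d4.
  pose G h a' := (mulA a1 (L d1) \ot mulH h y1) \ot (mulA a2 a' \ot mulH (R d4) y2).
  by rewrite (sw_matched (F := G)) // /G; mlin.
rewrite (sw_tensor_comul cH cA); last by mlin.
apply: eq_sw => x1 x2; apply: eq_sw => b1 b2.
rewrite !bicrossed_mul_sw (sw_bilinl _ _ _ (@tens_bilin _ _ _)).
by apply: eq_sw => d1 d2; rewrite (sw_bilinr _ _ _ (@tens_bilin _ _ _)).
Qed.

Lemma bicrossed_counitM s t : epsAH (mul s t) = epsAH s * epsAH t.
Proof.
move: s t; apply: (eq_on_tens2 (U := k^o)); [by mlin | by mlin |].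
move=> a x b y; rewrite bicrossed_mul_sw (linear_of_sw (U := A \ox H) (X := k^o) _ _ eAH).
(* Both actions preserve counits, so the left side is a sum of products of counits of [d1] and [d2];
   the counit law of [H \ox A] collapses it. *)
have := sw_counitl cHA (x \ot b)
  (f := fun d => epsA a * epsHA d * epsH y : k^o).
rewrite !tensor_counit_tens // => E.
transitivity (epsA a * (epsH x * epsA b) * epsH y); last by rewrite -!mulrA.
rewrite -E; last by mlin.
apply: eq_sw => d1 d2; rewrite tensor_counit_tens // (hopf_counitM hA).
rewrite (hopf_counitM hH) (coalgebra_map_counit (mp_lcoalgebra hm)).
rewrite (coalgebra_map_counit (mp_rcoalgebra hm)) /GRing.scale /=.
by rewrite [epsA a * _]mulrC -!mulrA.
Qed.

(** An antipode reverses products, and [a \ot x] is the product of [a \ot oneH] and [oneH]'s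
    counterpart [oneA \ot x]; this dictates the formula. *)
Definition bicrossed_antipode (t : A \ox H) : A \ox H :=
  \sw_(a, x <- t) mul (oneA \ot SH x) (SA a \ot oneH).

Lemma bicrossed_antipode_tens a x :
  bicrossed_antipode (a \ot x) = mul (oneA \ot SH x) (SA a \ot oneH).
Proof. by rewrite /bicrossed_antipode sw_tens; last by mlin. Qed.

Lemma bicrossed_antipode_linear : linear bicrossed_antipode.
Proof. by rewrite /bicrossed_antipode; mlin. Qed.
Let sAH := bicrossed_antipode_linear.

Lemma bicrossed_hopf :
  is_hopf mul (oneA \ot oneH) DeltaAH epsAH bicrossed_antipode.
Proof.
have tE a x : a \ot x = mul (a \ot oneH) (oneA \ot x).
  by rewrite bicrossed_mul_oner (mul_1l algH).
split=> //; first exact: bicrossed_algebra; first exact: tensor_coalgebra.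
- exact: bicrossed_comulM.
(* Unit, coproduct and counit are those of the tensor product Hopf algebra, whichever product is
   used. *)
- exact: (hopf_comul1 (tensor_hopf hA hH)).
- exact: bicrossed_counitM.
- exact: (hopf_counit1 (tensor_hopf hA hH)).
- apply: eq_on_tens; [by mlin | by mlin | move=> a x].
  rewrite (sw_tensor_comul cA cH) ?tensor_counit_tens //; last by mlin.
  (* Associativity isolates the product of the two inner factors, in [A], which the antipode law of
     [A] reduces to a scalar; the antipode law of [H] then finishes. *)
  transitivity (\sw_(x1, x2 <- DeltaH x) mul (oneA \ot SH x1)
      (mul (\sw_(a1, a2 <- DeltaA a) mul (SA a1 \ot oneH) (a2 \ot oneH))
           (oneA \ot x2))).
    rewrite exchange_sw; apply: eq_sw => x1 x2.
    rewrite sw_bilinl // sw_bilinr //; apply: eq_sw => a1 a2.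
    by rewrite bicrossed_antipode_tens [a2 \ot x2]tE !bicrossed_mulA.
  transitivity (\sw_(x1, x2 <- DeltaH x) epsA a *: (oneA \ot mulH (SH x1) x2)).
    apply: eq_sw => x1 x2; under eq_sw => a1 a2 do rewrite bicrossed_mul_onel.
    rewrite -(sw_bilinl _ _ _ (@tens_bilin _ _ _)) (antipode_l hA) tens_scalel.
    rewrite (linear_of_scale (g := mul^~ _)); last by mlin.
    rewrite linear_of_scale; last by mlin.
    by rewrite bicrossed_mul_oner (mul_1l algH) bicrossed_mul_oner.
  rewrite -(linear_of_sw (g := fun h => epsA a *: (oneA \ot h))); last by mlin.
  by rewrite (antipode_l hH) tens_scaler scalerA.
- apply: eq_on_tens; [by mlin | by mlin | move=> a x].
  rewrite (sw_tensor_comul cA cH) ?tensor_counit_tens //; last by mlin.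
  (* On this side the inner factors lie in [H], so [H] collapses first and [A] second. *)
  transitivity (\sw_(a1, a2 <- DeltaA a) mul (a1 \ot oneH)
      (mul (\sw_(x1, x2 <- DeltaH x) mul (oneA \ot x1) (oneA \ot SH x2))
           (SA a2 \ot oneH))).
    apply: eq_sw => a1 a2.
    rewrite sw_bilinl // sw_bilinr //; apply: eq_sw => x1 x2.
    by rewrite bicrossed_antipode_tens [a1 \ot x1]tE !bicrossed_mulA.
  transitivity (\sw_(a1, a2 <- DeltaA a) epsH x *: (mulA a1 (SA a2) \ot oneH)).
    apply: eq_sw => a1 a2; under eq_sw => x1 x2 do rewrite bicrossed_mul_oner.
    rewrite -(sw_bilinr _ _ _ (@tens_bilin _ _ _)) (antipode_r hH) tens_scaler.
    rewrite (linear_of_scale (g := mul^~ _)); last by mlin.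
    rewrite linear_of_scale; last by mlin.
    by rewrite bicrossed_mul_onel (mul_1l algA) bicrossed_mul_onel.
  rewrite -(linear_of_sw (g := fun h => epsH x *: (h \ot oneH))); last by mlin.
  by rewrite (antipode_r hA) tens_scalel scalerA mulrC.
Qed.

End Bicrossed.

(* Exchanges the sums at depths n and n + 1 of the left-hand side. *)
Ltac exchange_at n :=
  lazymatch n with
  | O => rewrite exchange_sw
  | S ?m => under eq_sw => ? ? do exchange_at m
  end.

(** * The brace identity on the tensor product *)

Theorem theorem2p1 (k : fieldType)
  (A : lmodType k) (DeltaA : A -> A \ox A) (epsA : A -> k)
  (mulA : A -> A -> A) (oneA : A) (SA : A -> A)
  (circ : A -> A -> A) (one_circ : A) (TA : A -> A)
  (hA : is_hopf_brace DeltaA epsA mulA oneA SA circ one_circ TA)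
  (H : lmodType k) (mulH : H -> H -> H) (oneH : H)
  (DeltaH : H -> H \ox H) (epsH : H -> k) (S : H -> H)
  (hH : is_hopf mulH oneH DeltaH epsH S)
  (hHcomm : commutative mulH)
  (hHcocomm : cocommutative DeltaH)
  (lact : H -> A -> A) (hlact : bilin lact)
  (ract : H -> A -> H) (hract : bilin ract)
  (hmodalg : is_module_algebra mulH oneH DeltaH epsH mulA oneA lact)
  (hmatched : is_matched_pair circ one_circ DeltaA epsA
                              mulH oneH DeltaH epsH lact ract)
  (hcompat : forall (a a' : A) (x : H), ract x (mulA a a') =
     \sw_(x1, x' <- DeltaH x) \sw_(x2, x3 <- DeltaH x')
       mulH (mulH (ract x1 a) (S x2)) (ract x3 a')) :
  exists S' T' : A \ox H -> A \ox H,
    is_hopf_brace (tensor_comul DeltaA DeltaH) (tensor_counit epsA epsH)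
      (tensor_mul mulA mulH) (oneA \ot oneH) S'
      (bicrossed_mul circ DeltaA mulH DeltaH lact ract) (one_circ \ot oneH) T'.
Proof.
have [hopfA hopfAc compA] := hA.
have cA := hopf_coalgebra hopfA; have cH := hopf_coalgebra hH.
have mA := mul_bilin (hopf_algebra hopfA).
have mc := mul_bilin (hopf_algebra hopfAc).
have mH := mul_bilin (hopf_algebra hH).
have lA := comul_linear cA; have lH := comul_linear cH.
have lSA := antipode_linear hopfA; have lSH := antipode_linear hH.
have hAH := tensor_hopf hopfA hH.
have hAHc := bicrossed_hopf hopfAc hH hmatched.
have cAH := hopf_coalgebra hAH; have lAH := comul_linear cAH.
have mAH := mul_bilin (hopf_algebra hAH).
have mAHc := mul_bilin (hopf_algebra hAHc).
have lS := antipode_linear hAH.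
exists (tensor_antipode SA S),
  (bicrossed_antipode circ one_circ DeltaA TA mulH oneH DeltaH S lact ract).
split=> //.
move=> r s t; move: r; apply: eq_on_tens; [by mlin | by mlin | move=> a x].
move: s t; apply: eq_on_tens2; [by mlin | by mlin | move=> b y c z].
(* The summand of the right side of the brace identity, with the five legs of [x] in their natural
   order. *)
pose F a1 a2 a3 b1 b2 c1 c2 x1 x2 x3 x4 x5 :=
  mulA (mulA (circ a1 (lact x1 b1)) (SA a2)) (circ a3 (lact x4 c1)) \ot
  mulH (mulH (mulH (ract x2 b2) y) (S x3)) (mulH (ract x5 c2) z).
transitivity (\sw_(a1, a' <- DeltaA a) \sw_(a2, a3 <- DeltaA a')
  \sw_(b1, b2 <- DeltaA b) \sw_(c1, c2 <- DeltaA c)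
  \sw_(x', x'' <- DeltaH x) \sw_(x1, x2 <- DeltaH x')
  \sw_(x3, w <- DeltaH x'') \sw_(x4, x5 <- DeltaH w)
    F a1 a2 a3 b1 b2 c1 c2 x1 x3 x4 x2 x5).
  rewrite tensor_mul_tens // bicrossed_mul_tens //.
  (* On the left, [x'] acts on the product of the legs of [b] and [c] and splits in two; [x''] is
     acted on by such a product and splits in three by [hcompat]. *)
  transitivity (\sw_(x', x'' <- DeltaH x)
    \sw_(b1, b2 <- DeltaA b) \sw_(c1, c2 <- DeltaA c) \sw_(x1, x2 <- DeltaH x')
    \sw_(a1, a' <- DeltaA a) \sw_(a2, a3 <- DeltaA a')
    \sw_(x3, w <- DeltaH x'') \sw_(x4, x5 <- DeltaH w)
      F a1 a2 a3 b1 b2 c1 c2 x1 x3 x4 x2 x5).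
    apply: eq_sw => x' x''; rewrite (sw_comulM _ _ hopfA); last by mlin.
    apply: eq_sw => b1 b2; apply: eq_sw => c1 c2.
    rewrite (module_algebra_mul hmodalg) (sw_bilinr _ _ _ mc).
    rewrite (sw_bilinl _ _ _ (@tens_bilin _ _ _)); apply: eq_sw => x1 x2.
    rewrite compA (sw_bilinl _ _ _ (@tens_bilin _ _ _)); apply: eq_sw => a1 a'.
    rewrite (sw_bilinl _ _ _ (@tens_bilin _ _ _)); apply: eq_sw => a2 a3.
    rewrite hcompat (sw_bilinl _ _ _ mH) (sw_bilinr _ _ _ (@tens_bilin _ _ _)).
    apply: eq_sw => x3 w.
    rewrite (sw_bilinl _ _ _ mH) (sw_bilinr _ _ _ (@tens_bilin _ _ _)).
    apply: eq_sw => x4 x5; rewrite /F; congr (_ \ot _).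
    have mHA := mul_assoc (hopf_algebra hH).
    (* The two products in [H] differ only in the place of [y], which commutativity moves past two
       factors. *)
    have mHAC u v w' : mulH (mulH u v) w' = mulH (mulH u w') v.
      by rewrite -!mHA [mulH v _]hHcomm.
    rewrite !mHA; congr (mulH _ _); rewrite [LHS]mHAC; congr (mulH _ _).
    by rewrite mHAC.
  exchange_at 3%N; exchange_at 2%N; exchange_at 1%N; exchange_at 0%N.
  exchange_at 4%N; exchange_at 3%N; exchange_at 2%N; exchange_at 1%N.
  by exchange_at 2%N; exchange_at 3%N.
(* The sums in the order in which the right side produces them. *)
transitivity (\sw_(a1, a' <- DeltaA a) \sw_(x', x'' <- DeltaH x)
  \sw_(a2, a3 <- DeltaA a') \sw_(x3, w <- DeltaH x'')
  \sw_(x1, x2 <- DeltaH x') \sw_(b1, b2 <- DeltaA b)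
  \sw_(x4, x5 <- DeltaH w) \sw_(c1, c2 <- DeltaA c)
    F a1 a2 a3 b1 b2 c1 c2 x1 x2 x3 x4 x5).
  symmetry.
  exchange_at 1%N; exchange_at 4%N; exchange_at 3%N; exchange_at 2%N.
  exchange_at 6%N; exchange_at 5%N; exchange_at 4%N; exchange_at 3%N.
  exchange_at 5%N.
  do 4 (apply: eq_sw => ? ?).
  (* Cocommutativity moves the leg that acts on [c1] into place. *)
  by apply: (sw_cocomm_move cH) => //; rewrite /F; mlin.
(* The coproduct of [a \ot x] gives the legs [x'], [x3], [w]; the two second products split [x'] and
   [w], and the antipode takes [x3]. *)
rewrite (sw_tensor_comul cA cH); last by mlin.
apply: eq_sw => a1 a'; apply: eq_sw => x' x''.
rewrite (sw_tensor_comul cA cH); last by mlin.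
apply: eq_sw => a2 a3; apply: eq_sw => x3 w.
rewrite (tensor_antipode_tens hopfA hH) !bicrossed_mul_tens //.
rewrite !(sw_bilinl _ _ _ mAH).
apply: eq_sw => x1 x2; rewrite !(sw_bilinl _ _ _ mAH).
apply: eq_sw => b1 b2; rewrite (sw_bilinr _ _ _ mAH).
apply: eq_sw => x4 x5; rewrite (sw_bilinr _ _ _ mAH).
by apply: eq_sw => c1 c2; rewrite !tensor_mul_tens.
Qed.
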